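(* Let $n\ge1$ and $r\ge2$ be integers, let $S=(s_1,\dots,s_n)$ be an integer vector with $0\le s_i\le r$, let $\mathcal{F}$ be a family of non-empty subsets of $[n]$, and let $\mathcal{P}=\{P_1,\dots,P_l\}$ be a partition of $[n]$ such that $w_S(P_j)\le r$ for every $j$. Then $$\chi(\mathrm{KG}_S^r(\mathcal{F},\mathcal{P}))\ge\left\lceil\frac{\mathrm{ecd}_S^r(\mathcal{F})}{r-1}\right\rceil.$$
   Context: For $P\subseteq[n]$, its $S$-weight is $w_S(P)=\sum_{i\in P}s_i$. A multiset $\{A_1,\dots,A_r\}$ of subsets of $[n]$ is $S$-disjoint if for every $i\in[n]$ the number of $j\in\{1,\dots,r\}$ with $i\in A_j$ is at most $s_i$. It is equitable if $||A_i|-|A_j||\le1$ for all $i,j$. Let $\bar n=\sum_{i=1}^ns_i$. The equitable $S$-disjoint $r$-colorability defect is $$\mathrm{ecd}_S^r(\mathcal{F})=\bar n-\max\Big\{\sum_{i=1}^r|A_i| : \{A_1,\dots,A_r\}\text{ equitable and }S\text{-disjoint, and }F\not\subseteq A_i\ \forall F\in\mathcal{F},\ 1\le i\le r\Big\}.$$ $\mathrm{KG}_S^r(\mathcal{F},\mathcal{P})$ is the $r$-uniform hypergraph whose vertices are those $A\in\mathcal{F}$ with $|A\cap P_j|\le1$ for all $j$, and whose edges are all multisets $\{A_1,\dots,A_r\}$ of vertices that are $S$-disjoint. $\chi$ is the chromatic number (minimum number of colors in a vertex coloring with no monochromatic edge). *)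

(* Defs.v *)
From HB Require Import structures.
From mathcomp Require Import all_boot all_order all_fingroup all_algebra.
From mathcomp Require Import boolp constructive_ereal.

Set Implicit Arguments.
Unset Strict Implicit.
Unset Printing Implicit Defensive.

Import Order.TTheory GRing.Theory Num.Theory.

(* Edges are multisets of r vertices, given by their r-indexed enumerations:
   repeated vertices are allowed, and the order of enumeration is irrelevant. *)
Record uhypergraph (r : nat) := UHypergraph {
  vertex : finType;
  edge : pred {ffun 'I_r -> vertex};
  edge_perm : forall (e : {ffun 'I_r -> vertex}) (p : 'S_r),
    edge [ffun j => e (p j)] = edge e
}.

Definition monochromatic (r k : nat) (V : finType) (c : {ffun V -> 'I_k})
    (e : {ffun 'I_r -> V}) : bool :=
  [forall i, forall j, c (e i) == c (e j)].

Definition colorable (r : nat) (H : uhypergraph r) (k : nat) : bool :=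
  [exists c : {ffun vertex H -> 'I_k},
     forall e : {ffun 'I_r -> vertex H}, edge e ==> ~~ monochromatic c e].

(* For r > 0, the value is +oo exactly when some edge consists of r copies of a single
   vertex, since no coloring is then proper. *)
Definition chromatic_number (r : nat) (H : uhypergraph r) : \bar int :=
  match pselect (exists k, colorable H k) with
  | left ex_k => (Posz (ex_minn ex_k))%:E%E
  | right _ => +oo%E
  end.

Definition weight (n : nat) (S : 'I_n -> nat) (P : {set 'I_n}) : nat :=
  \sum_(i in P) S i.

Definition S_disjoint (n r : nat) (S : 'I_n -> nat)
    (A : {ffun 'I_r -> {set 'I_n}}) : bool :=
  [forall i, #|[set j | i \in A j]| <= S i].

Definition equitable (n r : nat) (A : {ffun 'I_r -> {set 'I_n}}) : bool :=
  [forall i, forall j, (`|Posz #|A i| - Posz #|A j| | <= 1)%R].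

Definition ecd_admissible (n r : nat) (S : 'I_n -> nat)
    (F : {set {set 'I_n}}) (A : {ffun 'I_r -> {set 'I_n}}) : bool :=
  [&& equitable A, S_disjoint S A
    & [forall B in F, forall i, ~~ (B \subset A i)]].

(* If set0 \notin F then the constant family set0 is admissible, so the
   maximum is attained; by ecd_max_le the subtraction is exact. *)
Definition ecd_max (n r : nat) (S : 'I_n -> nat) (F : {set {set 'I_n}}) : nat :=
  \max_(A : {ffun 'I_r -> {set 'I_n}} | ecd_admissible S F A)
     \sum_(i < r) #|A i|.

Definition ecd (n r : nat) (S : 'I_n -> nat) (F : {set {set 'I_n}}) : nat :=
  \sum_(i < n) S i - ecd_max r S F.

Lemma ecd_max_le (n r : nat) (S : 'I_n -> nat) (F : {set {set 'I_n}}) :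
  ecd_max r S F <= \sum_(i < n) S i.
Proof.
apply/bigmax_leqP => A /and3P[_ /forallP dA _].
have -> : \sum_(j < r) #|A j| = \sum_(i < n) #|[set j | i \in A j]|.
  under eq_bigr do rewrite -sum1_card.
  rewrite (exchange_big_dep predT) //=.
  by apply: eq_bigr => i _; rewrite sum1dep_card.
by apply: leq_sum => i _.
Qed.

Section KneserHypergraph.
Variables (n r : nat) (S : 'I_n -> nat) (F P : {set {set 'I_n}}).

Definition KG_vertices : {set {set 'I_n}} :=
  [set A in F | [forall B in P, #|A :&: B| <= 1]].

Definition KG_vertex : finType := {A : {set 'I_n} | A \in KG_vertices}.

Definition KG_edge (e : {ffun 'I_r -> KG_vertex}) : bool :=
  S_disjoint S [ffun j => val (e j)].

Lemma KG_edge_perm (e : {ffun 'I_r -> KG_vertex}) (p : 'S_r) :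
  KG_edge [ffun j => e (p j)] = KG_edge e.
Proof.
rewrite /KG_edge /S_disjoint; apply: eq_forallb => i.
congr leq; rewrite -[RHS](card_preimset _ (@perm_inj _ p)).
by apply: eq_card => j; rewrite !inE !ffunE.
Qed.

Definition KG : uhypergraph r := UHypergraph KG_edge_perm.

End KneserHypergraph.

(* Main.v *)
Require Import Defs.
From HB Require Import structures.
From mathcomp Require Import all_boot all_order all_fingroup all_algebra.
From mathcomp Require Import boolp constructive_ereal.
From mathcomp Require Import zify ring.

Set Implicit Arguments.
Unset Strict Implicit.
Unset Printing Implicit Defensive.

Import GRing.Theory.

(** Kriz's reduction: if r = r1 * r2, call a set "bad" when the equitable bound for
    r1 fails inside it, colour each bad set by a monochromatic r1-edge that it must
    contain, and apply the bound for r2 to the bad sets.  This preserves the bound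
    when a factor t is introduced (blocks of size at most r * t, colour classes
    meeting each block at most t times), so r may be assumed prime.  Replacing i by
    S i copies of itself makes S-disjointness plain disjointness.

    For r = p prime, apply the Z_p-Tucker lemma to the partial p-colourings X of the
    ground set.  If some class of X contains an edge of the family, label X by the
    colour of such an edge; otherwise label it by the largest total size of an
    equitable p-tuple of capped subsets of its classes.  Blocks of size at most p * t
    are exactly what makes the sign of the latter label monotone.

    The Z_p-Tucker lemma is proved with cochains.  The free complex of labels carries
    cochains a_k, a_0 = 1, with (d a_k) = theta_k a_(k+1) for the periodic resolution
    theta, and a_k = 0 once k exceeds the number of vertices of every simplex.  Pulled
    back to the poset of partial colourings, whose reduced cohomology vanishes below
    the top degree, they force a_0 into p times the constants modulo p. *)

(** * Reduced cochains on vertex sequences and the prism homotopy *)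

Section Cochains.
Local Open Scope ring_scope.
Variable R : comNzRingType.

(* A cochain is a function on finite sequences of vertices, repetitions allowed.
   Cochains on the empty sequence are kept, so the cohomology is reduced. *)
Fixpoint cobord (T : Type) (a : seq T -> R) (s : seq T) : R :=
  if s is x :: s' then a s' - cobord (fun u => a (x :: u)) s' else 0.

Lemma eq_cobord (T : eqType) (a b : seq T -> R) s :
  (forall u, subseq u s -> size s = (size u).+1 -> a u = b u) ->
  cobord a s = cobord b s.
Proof.
elim: s a b => //= x s IH a b ab; congr (_ - _).
  by apply: ab => //; apply: subseq_cons.
by apply: IH => u us su; apply: ab; rewrite /= ?eqxx ?su.
Qed.

Lemma eq_cobord_all (T : Type) (a b : seq T -> R) s :
  a =1 b -> cobord a s = cobord b s.
Proof.
elim: s a b => //= x s IH a b ab; rewrite ab; congr (_ - _).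
by apply: IH => u; apply: ab.
Qed.

Lemma cobord0 (T : Type) (s : seq T) : cobord (fun=> 0) s = 0.
Proof. by elim: s => //= x s ->; rewrite subrr. Qed.

Lemma cobordB (T : Type) (a b : seq T -> R) s :
  cobord (fun u => a u - b u) s = cobord a s - cobord b s.
Proof.
elim: s a b => [|x s IH] a b /=; first by rewrite subrr.
by rewrite IH; ring.
Qed.

Lemma cobordN (T : Type) (a : seq T -> R) s :
  cobord (fun u => - a u) s = - cobord a s.
Proof.
have := cobordB (fun=> 0) a s; rewrite cobord0 sub0r => <-.
by apply: eq_cobord_all => u; rewrite sub0r.
Qed.

Lemma cobord_sum (T I : Type) (r : seq I) (a : I -> seq T -> R) s :
  cobord (fun u => \sum_(i <- r) a i u) s = \sum_(i <- r) cobord (a i) s.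
Proof.
elim: s a => [|x s IH] a /=; first by rewrite big1.
by rewrite IH sumrB.
Qed.

Lemma cobord_map (T T' : Type) (f : T -> T') (a : seq T' -> R) s :
  cobord (fun u => a (map f u)) s = cobord a (map f s).
Proof. by elim: s a => //= x s IH a; rewrite (IH (fun u => a (f x :: u))). Qed.

Lemma cobordK (T : Type) (a : seq T -> R) s : cobord (cobord a) s = 0.
Proof. by elim: s a => //= x s IH a; rewrite cobordB IH subr0 subrr. Qed.

(** Vanishing on adjacent repetitions is a clause of its own because antisymmetry does not imply it
    in characteristic 2, which occurs for [p = 2]. *)
Definition alternating (T : Type) (a : seq T -> R) : Prop :=
  (forall s1 x y s2, a (s1 ++ x :: y :: s2) = - a (s1 ++ y :: x :: s2)) /\
  (forall s1 x s2, a (s1 ++ x :: x :: s2) = 0).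

Lemma alternating_cons (T : Type) (a : seq T -> R) x :
  alternating a -> alternating (fun u => a (x :: u)).
Proof.
by case=> aC aD; split=> [s1 y z s2|s1 y s2]; [apply: (aC (x :: s1))|apply: (aD (x :: s1))].
Qed.

Lemma alternating_cobord (T : Type) (a : seq T -> R) :
  alternating a -> alternating (cobord a).
Proof.
move=> alta; split=> s1.
  elim: s1 a alta => [|z s1 IH] a alta x y s2 /=.
    rewrite (eq_cobord_all (b := fun u => - a [:: y, x & u])); last first.
      by move=> u; apply: (alta.1 [::]).
    by rewrite cobordN; ring.
  by rewrite IH ?opprB; [rewrite alta.1 opprK addrC|apply: alternating_cons].
elim: s1 a alta => [|z s1 IH] a alta x s2 /=.
  rewrite (eq_cobord_all (b := fun u => 0)) ?cobord0 ?subr0 ?subrr // => u.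
  exact: (alta.2 [::]).
by rewrite IH ?alta.2 ?subrr//; apply: alternating_cons.
Qed.

(** Adjacent transpositions bring an entry next to its twin. This kills cochains on sequences longer
    than the number of available labels. *)
Lemma alternating_repeat (T : eqType) (a : seq T -> R) s :
  alternating a -> ~~ uniq s -> a s = 0.
Proof.
elim: s a => // x s IH a alta /=; rewrite negb_and negbK => /orP[|nus]; last first.
  exact: (IH (fun u => a (x :: u)) (alternating_cons x alta)).
case/splitPr => u v {IH}; elim: u a alta => [|y u IH] a alta /=.
  exact: (alta.2 [::]).
rewrite (alta.1 [::]) /= (IH (fun u => a (y :: u))) ?oppr0 //.
exact: alternating_cons.
Qed.

(* The chain homotopy between the identity and h. *)
Fixpoint prism (T : Type) (h : T -> T) (a : seq T -> R) (s : seq T) : R :=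
  if s is x :: s' then
    a [:: x, h x & map h s'] - prism h (fun u => a (x :: u)) s'
  else 0.

Lemma prism_eq0 (T : Type) (h : T -> T) (a : seq T -> R) s :
  (forall u x v, s = rcons u x ++ v -> a (rcons u x ++ h x :: map h v) = 0) ->
  prism h a s = 0.
Proof.
elim: s a => //= x s IH a Pa; have /= -> := Pa [::] x s erefl.
rewrite sub0r IH ?oppr0// => u y v suv.
by apply: (Pa (x :: u)); rewrite suv.
Qed.

Lemma prismB (T : Type) (h : T -> T) (a b : seq T -> R) s :
  prism h (fun u => a u - b u) s = prism h a s - prism h b s.
Proof.
elim: s a b => [|x s IH] a b /=; first by rewrite subrr.
by rewrite IH; ring.
Qed.

Lemma prism_homotopy (T : Type) (h : T -> T) (a : seq T -> R) s :
  cobord (prism h a) s + prism h (cobord a) s = a (map h s) - a s.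
Proof.
elim: s a => [|x s IH] a /=; first by rewrite addr0 subrr.
rewrite cobordB (cobord_map h (fun u => a [:: x, h x & u])) prismB.
have /= := IH (fun u => a (x :: u)).
set A := cobord (prism _ _) _; set B := prism h (cobord _) _.
set E := a (x :: map h s) => AB.
transitivity (A + B + a (h x :: map h s) - E); first by ring.
by rewrite AB /E; ring.
Qed.

End Cochains.

(** * Equivariant maps to the cyclic group of prime order *)

Section EquivariantChoice.
Variables (p : nat) (p_prime : prime p).

Lemma val_iter_ordS k (i : 'I_p) : val (iter k (@ordS p) i) = (i + k) %% p.
Proof.
elim: k => [|k IH] /=; first by rewrite addn0 modn_small.
by rewrite IH -addn1 modnDml addn1 addnS.
Qed.

Lemma iter_ordS_p (i : 'I_p) : iter p (@ordS p) i = i.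
Proof. by apply: val_inj; rewrite val_iter_ordS modnDr modn_small. Qed.

Lemma iter_ordS_onto (i j : 'I_p) : exists k, iter k (@ordS p) i = j.
Proof.
exists (j + (p - i)); apply: val_inj; rewrite val_iter_ordS.
rewrite addnCA subnKC ?modnDr ?modn_small//; exact: ltnW.
Qed.

Lemma ordS_neq (i : 'I_p) : ordS i != i.
Proof.
apply/eqP => /(congr1 val) /= e.
have := ltn_ord i; have := prime_gt1 p_prime; move: e.
case: (ltngtP i.+1 p) => [lt|gt|eq]; last 1 first.
- by rewrite eq modnn; lia.
- by rewrite modn_small //; lia.
- lia.
Qed.

(** As [p] is prime, an orbit of [tau] is a fixed point or has exactly [p] elements. A value allowed
    by [Q] is chosen at the root of each orbit and rotated along it. At a fixed point equivariance
    is impossible, and only [Q] is asked. *)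
Lemma equivariant_choice (W : finType) (tau : W -> W) (Q : W -> 'I_p -> bool) :
  (forall x, iter p tau x = x) ->
  (forall x, exists i, Q x i) ->
  (forall x i, Q x i -> Q (tau x) (ordS i)) ->
  exists sg : W -> 'I_p, forall x,
    Q x (sg x) /\ (tau x != x -> sg (tau x) = ordS (sg x)).
Proof.
move=> taup exQ Qtau.
have [g Qg] := fin_all_exists exQ.
have tauI : injective tau.
  move=> x y xy; rewrite -[x]taup -[y]taup -(prednK (prime_gt0 p_prime)).
  by rewrite !iterSr xy.
have order_p x : tau x != x -> fingraph.order tau x = p.
  move=> tx; set o := fingraph.order tau x.
  have o_gt0 : 0 < o by apply: fingraph.order_gt0.
  have : o %| p.
    rewrite /dvdn; apply/negPn/negP => /eqP ne.
    have ox : iter (p %% o) tau x = x.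
      rewrite -[RHS]taup [in RHS](divn_eq p o) addnC iterD; congr iter.
      by elim: (p %/ o) => //= m IH; rewrite mulSn iterD -IH /o iter_order.
    have := @findex_iter _ tau x (p %% o) (ltn_pmod _ o_gt0).
    rewrite ox findex0 => e; exact: ne.
  case/primeP: p_prime => _ h /h /orP[/eqP o1|/eqP //].
  by case/eqP: tx; rewrite -[RHS](iter_order tauI) -/o o1.
have fc := fconnect_sym tauI.
pose rt x := froot tau x; pose k x := findex tau (rt x) x.
have rtE x : iter (k x) tau (rt x) = x.
  by rewrite iter_findex // fc connect_root.
exists (fun x => iter (k x) (@ordS p) (g (rt x))) => x; split=> [|tx].
  rewrite -{1}(rtE x); elim: (k x) => //= m; exact: Qtau.
have trt : tau (rt x) != rt x.
  apply: contra tx => /eqP e; rewrite -(rtE x); apply/eqP.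
  by elim: (k x) => //= m IHm; rewrite IHm.
have kx : k x < p by rewrite -(order_p _ trt) findex_max // fc connect_root.
have rtx : rt (tau x) = rt x.
  by apply/eqP; rewrite /rt root_connect // fc fconnect1.
have ->: k (tau x) = findex tau (rt x) (iter (k x).+1 tau (rt x)).
  by rewrite /k rtx [in RHS]iterS rtE.
rewrite rtx.
have [lt|le] := ltnP (k x).+1 p; first by rewrite findex_iter // (order_p _ trt).
(* The last element of a free orbit returns to the root, and [p] rotations of the chosen value
   return it as well. *)
have kp : (k x).+1 = p by apply/eqP; rewrite eqn_leq kx le.
by rewrite -iterS kp taup findex0 iter_ordS_p.
Qed.

End EquivariantChoice.

(** * The periodic resolution and the transferred cochains *)

Section PeriodicCochains.
Local Open Scope ring_scope.
Variables (R : comNzRingType) (p : nat) (p_gt0 : (0 < p)%N).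
Variables (T : eqType) (tau : T -> T).
Hypothesis taup : forall x, iter p tau x = x.

(* The differentials of the periodic resolution of the cyclic group of order p
   generated by tau: the norm for k even, 1 - tau for k odd. *)
Definition theta (k : nat) (f : seq T -> R) (s : seq T) : R :=
  if odd k then f s - f (map tau s)
  else \sum_(j < p) f (map (iter j tau) s).

Lemma eq_theta k f g s :
  (forall j, f (map (iter j tau) s) = g (map (iter j tau) s)) ->
  theta k f s = theta k g s.
Proof.
move=> fg; rewrite /theta; case: odd; last by apply: eq_bigr => j _.
by have := fg 0; have := fg 1; rewrite /= map_id => -> ->.
Qed.

Lemma thetaD k f g s :
  theta k (fun u => f u + g u) s = theta k f s + theta k g s.
Proof. by rewrite /theta; case: odd; [ring | rewrite big_split]. Qed.

Lemma cobord_theta k f s : cobord (theta k f) s = theta k (cobord f) s.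
Proof.
rewrite /theta; case: odd.
  by rewrite (cobordB f (fun u => f (map tau u))) cobord_map.
rewrite (cobord_sum _ (fun (j : 'I_p) u => f (map (iter j tau) u))).
by apply: eq_bigr => j _; rewrite cobord_map.
Qed.

Lemma norm_shift (f : seq T -> R) s :
  \sum_(j < p) f (map (iter j tau) (map tau s))
  = \sum_(j < p) f (map (iter j tau) s).
Proof.
have e (j : nat) : map (iter j tau) (map tau s) = map (iter j.+1 tau) s.
  by rewrite -map_comp; apply: eq_map => x; rewrite iterSr.
under eq_bigr do rewrite e.
case: p p_gt0 taup => // q _ tq.
rewrite big_ord_recr big_ord_recl /= addrC map_id; congr (_ + _).
by congr f; rewrite -[RHS]map_id; apply: eq_map => x; apply: tq.
Qed.

Lemma thetaK k f s : theta k (theta k.+1 f) s = 0.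
Proof.
rewrite /theta /=; case: odd => /=; first by rewrite norm_shift subrr.
rewrite sumrB; apply/eqP; rewrite subr_eq0; apply/eqP.
rewrite -[LHS]norm_shift; apply: eq_bigr => j _; congr f.
rewrite -!map_comp; apply: eq_map => x /=; by rewrite -iterSr.
Qed.

(** [good] sequences play the simplices of the label complex. The equivariant [rho] witnesses that
    rotation acts freely on the nonempty ones; its symmetry keeps lifts alternating. *)
Variable good : pred (seq T).
Hypothesis good_sub : forall u s, subseq u s -> good s -> good u.
Hypothesis good_tau : forall s, good s -> good (map tau s).
Variable rho : seq T -> nat.
Hypothesis rho_lt : forall s, (rho s < p)%N.
Hypothesis rho_swap : forall s1 x y s2,
  rho (s1 ++ x :: y :: s2) = rho (s1 ++ y :: x :: s2).
Hypothesis rho_tau : forall s,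
  good s -> s != [::] -> rho (map tau s) = ((rho s).+1 %% p)%N.

Lemma good_iter j s : good s -> good (map (iter j tau) s).
Proof.
move=> gs; elim: j => [|j IH]; first by rewrite map_id.
by have := good_tau IH; rewrite -map_comp.
Qed.

Lemma rho_iter j s :
  good s -> s != [::] -> rho (map (iter j tau) s) = ((rho s + j) %% p)%N.
Proof.
move=> gs s0; elim: j => [|j IH]; first by rewrite map_id addn0 modn_small.
have -> : map (iter j.+1 tau) s = map tau (map (iter j tau) s).
  by rewrite -map_comp.
rewrite rho_tau ?good_iter//; last by case: (s) s0.
by rewrite IH -addn1 modnDml addn1 addnS.
Qed.

(* On a free orbit the kernel of the norm is the image of 1 - tau and
   conversely; rho picks a base point of each orbit, hence explicit preimages. *)
Definition lift (k : nat) (z : seq T -> R) (s : seq T) : R :=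
  if odd k then \sum_(j < p - rho s) z (map (iter j tau) s)
  else if rho s == 0 then z s else 0.

(** For [k] odd the partial sums telescope to [z s]; when [rho] wraps around to 0, the subtracted
    sum is a full norm of [z], which vanishes. For [k] even [z] is invariant under [tau], and
    exactly one rotation of [s] has [rho] equal to 0. *)
Lemma theta_lift k z s :
  good s -> s != [::] ->
  (forall u, good u -> size u = size s -> theta k.+1 z u = 0) ->
  theta k (lift k z) s = z s.
Proof.
move=> gs s0 z0; rewrite /theta /lift; case: (boolP (odd k)) => /= ok.
  have rp := rho_lt s.
  rewrite rho_tau //; have [lt|le] := ltnP (rho s).+1 p.
    rewrite modn_small // (_ : (p - rho s)%N = (p - (rho s).+1).+1); last by lia.
    rewrite big_ord_recl /= map_id [X in _ + X - _](eq_bigr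
      (fun j : 'I__ => z (map (iter j tau) (map tau s)))) ?addrK // => j _.
    by congr z; rewrite -map_comp; apply: eq_map => x /=; rewrite -iterSr.
  have e : (rho s).+1 = p by lia.
  rewrite e modnn subn0 -[X in (X - _)%N]e subSnn big_ord1 /= map_id.
  have := z0 (map tau s) (good_tau gs) (size_map _ _).
  by rewrite /theta /= ok /= => ->; rewrite subr0.
have zt u : good u -> size u = size s -> z (map tau u) = z u.
  move=> gu su; have := z0 u gu su; rewrite /theta /= ok.
  by move/eqP; rewrite subr_eq0 => /eqP.
have zi j : z (map (iter j tau) s) = z s.
  elim: j => [|j IH]; first by rewrite map_id.
  rewrite [map _ s](_ : _ = map tau (map (iter j tau) s)) -?map_comp //.
  by rewrite map_comp zt ?size_map // good_iter.
under eq_bigr do rewrite zi.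
rewrite -big_mkcond sumr_const -[RHS]mulr1n; congr (_ *+ _).
set r := rho s.
(* The one rotation that brings [rho s] to 0; the remainder covers the case where it is 0
   already. *)
have jP : ((p - r) %% p < p)%N by rewrite ltn_pmod.
rewrite (@eq_card1 _ (Ordinal jP)) // => j.
rewrite unfold_in /= inE rho_iter // -/r -val_eqE /=.
have := ltn_ord j; have := rho_lt s; rewrite -/r => rp jp.
case: (posnP r) => [-> |r0].
  by rewrite add0n subn0 modnn modn_small.
rewrite [in RHS]modn_small; last by lia.
have [lt|le] := ltnP (r + j) p; first by rewrite modn_small //; lia.
rewrite -(subnK le) modnDr modn_small; lia.
Qed.

(** The index is the length of the sequences on which the cochain matters, one more than the
    simplicial degree. *)
Fixpoint transfer (k : nat) : seq T -> R :=
  if k is k'.+1 then lift k' (cobord (transfer k')) else fun s => (nilp s)%:R.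

(** A lift exists because [theta k.+1] kills the coboundary: [theta] has period 2 and commutes with
    [cobord], so for positive [k] the previous relation turns the composite into a double
    coboundary. For [k = 0] the coboundary is constant on singletons, hence killed by 1 - [tau]. *)
Lemma transfer_cocycle k s :
  good s -> size s = k.+1 -> cobord (transfer k) s = theta k (transfer k.+1) s.
Proof.
elim: k s => [|k IH] s gs ss; rewrite theta_lift //; try by case: (s) ss.
  move=> [|x [|]] // gu; rewrite ss // => _.
  by rewrite /theta /= subrr.
move=> u gu su.
have -> : theta k.+2 (cobord (transfer k.+1)) u
          = theta k (cobord (transfer k.+1)) u by rewrite /theta /= negbK.
rewrite -cobord_theta -[RHS](cobordK (transfer k) u).
apply: eq_cobord => v vu sv; rewrite IH //; first exact: good_sub gu.
by move: sv; rewrite su ss => -[].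
Qed.

Lemma alternating_lift k z : alternating z -> alternating (lift k z).
Proof.
move=> altz; split=> [s1 x y s2|s1 x s2]; rewrite /lift; case: (odd k).
- rewrite (rho_swap s1 x) -sumrN; apply: eq_bigr => j _.
  by rewrite !map_cat altz.1.
- by rewrite (rho_swap s1 x) altz.1; case: ifP; rewrite ?oppr0.
- by rewrite big1 // => j _; rewrite map_cat altz.2.
- by rewrite altz.2 if_same.
Qed.

Lemma alternating_transfer k : alternating (transfer k).
Proof.
elim: k => [|k IH]; last exact/alternating_lift/alternating_cobord.
by split=> [[|? ?] x y s2|[|? ?] x s2]; rewrite /= ?oppr0.
Qed.

End PeriodicCochains.

(** * Partial colourings with [p] colours, their order and their rotation *)

Section SignedVectors.
Variables (p : nat) (p_prime : prime p) (V : finType).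

Definition svec := {ffun V -> option 'I_p}.
Implicit Types X Y : svec.

Definition shift X : svec := [ffun v => omap (@ordS p) (X v)].
Definition sle : rel svec := fun X Y => [forall v, (X v == None) || (X v == Y v)].
(** The zero vector is excluded because [shift] fixes it. *)
Definition svec_on (D : {set V}) : pred svec :=
  fun X => [exists v, X v] && [forall v, X v ==> (v \in D)].
(** The order is weak because cochains are evaluated on sequences with repetitions. *)
Definition schain (D : {set V}) (s : seq svec) : bool :=
  pairwise sle s && all (svec_on D) s.

Lemma sleP X Y : reflect (forall v i, X v = Some i -> Y v = Some i) (sle X Y).
Proof.
apply: (iffP forallP) => h v.
  by move=> i Xv; move: (h v); rewrite Xv => /eqP.
by case Xv: (X v) => [i|] //=; rewrite (h v i Xv).
Qed.

Lemma sle_refl : reflexive sle.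
Proof. by move=> X; apply/sleP. Qed.

Lemma sle_trans : transitive sle.
Proof. by move=> Y X Z /sleP XY /sleP YZ; apply/sleP => v i /XY /YZ. Qed.

Lemma svec_onP (D : {set V}) X :
  reflect ((exists v i, X v = Some i) /\ forall v i, X v = Some i -> v \in D)
    (svec_on D X).
Proof.
apply: (iffP andP) => -[].
  move=> /existsP[v Xv] /forallP XD; split.
    by exists v; case: (X v) Xv => // i; exists i.
  by move=> u i Xu; move: (XD u); rewrite Xu.
move=> [v [i Xv]] XD; split; first by apply/existsP; exists v; rewrite Xv.
by apply/forallP => u; case Xu: (X u) => [j|] //=; apply: XD Xu.
Qed.

Lemma shift_Some X v i : (shift X v == Some (ordS i)) = (X v == Some i).
Proof.
rewrite ffunE; case: (X v) => //= j; by apply/eqP/eqP => [/Some_inj/ordS_inj ->|[->]].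
Qed.

Lemma shift_p X : iter p shift X = X.
Proof.
have e k v : iter k shift X v = omap (iter k (@ordS p)) (X v).
  by elim: k => [|k IH] /=; [case: (X v)|rewrite ffunE IH; case: (X v)].
by apply/ffunP => v; rewrite e; case: (X v) => //= i; rewrite iter_ordS_p.
Qed.

Lemma sle_shift X Y : sle X Y -> sle (shift X) (shift Y).
Proof.
move=> /sleP XY; apply/sleP => v i; rewrite !ffunE.
by case Xv: (X v) => [j|] //= <-; rewrite (XY v j Xv).
Qed.

Lemma svec_on_shift D X : svec_on D X -> svec_on D (shift X).
Proof.
move=> /svec_onP[[v [i Xv]] XD]; apply/svec_onP; split.
  by exists v, (ordS i); apply/eqP; rewrite shift_Some Xv.
by move=> u j; rewrite ffunE; case Xu: (X u) => [k|] // _; apply: XD Xu.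
Qed.

Lemma shift_neq D X : svec_on D X -> shift X != X.
Proof.
move=> /svec_onP[[v [i Xv]] _]; apply/eqP => /(congr1 (fun f : svec => f v)).
by rewrite ffunE Xv /= => /Some_inj/eqP; apply/negP; apply: ordS_neq.
Qed.

Lemma schain_sub D u s : subseq u s -> schain D s -> schain D u.
Proof.
move=> us /andP[ps /allP sD]; rewrite /schain (subseq_pairwise us ps) /=.
by apply/allP => X /(mem_subseq us); apply: sD.
Qed.

Lemma schain_shift D s : schain D s -> schain D (map shift s).
Proof.
move=> /andP[ps /allP sD]; rewrite /schain pairwise_map all_map.
rewrite (sub_pairwise _ ps); last by move=> X Y; apply: sle_shift.
by apply/allP => X /sD; apply: svec_on_shift.
Qed.

Lemma schain_total D s X Y : schain D s -> X \in s -> Y \in s -> sle X Y || sle Y X.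
Proof.
case/andP=> + _; elim: s => //= Z s IH /andP[/allP Zs ps].
rewrite !inE => /orP[/eqP ->|Xs] /orP[/eqP ->|Ys].
- by rewrite sle_refl.
- by rewrite Zs.
- by rewrite Zs ?orbT.
- exact: IH.
Qed.

Lemma schain_last D s : schain D s -> s != [::] ->
  exists2 Y, Y \in s & forall X, X \in s -> sle X Y.
Proof.
case/lastP: s => // s Y /andP[+ _] _; rewrite pairwise_rcons => /andP[/allP sY _].
exists Y; first by rewrite mem_rcons inE eqxx.
by move=> X; rewrite mem_rcons inE => /orP[/eqP ->|/sY //]; apply: sle_refl.
Qed.

(** * Vanishing of the reduced cohomology of signed vectors *)

Section Acyclicity.
Local Open Scope ring_scope.
Variable R : comNzRingType.

(** The inequalities contract [U] to [e]: the prism deforms the identity into [h], and coning with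
    [e] kills the image of [h]. *)
Lemma cone_acyclic (U : pred svec) (h : svec -> svec) (e : svec) :
  U e -> (forall X, U X -> [/\ U (h X), sle X (h X) & sle e (h X)]) ->
  (forall X Y, sle X Y -> sle (h X) (h Y)) ->
  forall k (z : seq svec -> R),
  (forall s, pairwise sle s -> all U s -> size s = k.+1 -> cobord z s = 0) ->
  exists b, forall s, pairwise sle s -> all U s -> size s = k -> z s = cobord b s.
Proof.
move=> Ue Uh hle k z z0.
exists (fun s => z (e :: map h s) - prism h z s) => s ps /allP sU ss.
rewrite (cobordB (fun u => z (e :: map h u))).
rewrite (cobord_map h (fun u => z (e :: u))).
(* The interleaved sequences of the prism are again chains in [U], of length [k.+1], so [cobord z]
   vanishes on them. *)
have := prism_homotopy h z s; rewrite prism_eq0 => [|u x v suv]; last first.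
  move: ps sU ss; rewrite suv pairwise_cat.
  case/and3P=> uv pu pv sU; rewrite size_cat size_rcons addSn => -[sz].
  have xu : x \in rcons u x by rewrite mem_rcons inE eqxx.
  have xU : U x by apply: sU; rewrite mem_cat xu.
  have ux y : y \in rcons u x -> sle y x.
    move: pu; rewrite pairwise_rcons mem_rcons inE => /andP[/allP uxs _].
    by case/orP=> [/eqP ->|/uxs //]; apply: sle_refl.
  have vh y : y \in v -> [/\ U y, sle y (h y) & sle x y].
    move=> yv; have yU : U y by apply: sU; rewrite mem_cat yv orbT.
    have [_ yh _] := Uh y yU; split=> //.
    by move/allrelP: uv; apply.
  have [hxU xhx _] := Uh x xU.
  apply: z0.
  - rewrite pairwise_cat pu /= pairwise_map; apply/and3P; split.
    + apply/allrelP => y w yu; rewrite inE => /orP[/eqP ->|/mapP[w' wv ->]].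
        exact: sle_trans (ux y yu) xhx.
      have [_ wh xw] := vh w' wv.
      exact: sle_trans (ux y yu) (sle_trans xw wh).
    + by apply/allP => _ /mapP[w wv ->]; have [_ _ xw] := vh w wv; apply: hle.
    + by apply: sub_pairwise pv => y w; apply: hle.
  - apply/allP => y; rewrite mem_cat inE.
    case/or3P=> [yu|/eqP -> //|/mapP[w wv ->]].
      by apply: sU; rewrite mem_cat yu.
    by have [Uw _ _] := vh w wv; have [] := Uh w Uw.
  - by rewrite size_cat size_rcons /= size_map addSn addnS sz.
have : cobord z (e :: map h s) = 0.
  apply: z0; rewrite /= ?size_map ?ss // ?pairwise_map.
    rewrite (sub_pairwise _ ps) ?andbT; last by move=> X Y; apply: hle.
    by apply/allP => _ /mapP[w ws ->]; have [] := Uh w (sU w ws).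
  by rewrite Ue; apply/allP => _ /mapP[w ws ->]; have [] := Uh w (sU w ws).
rewrite /= addr0 => /eqP; rewrite subr_eq0 => /eqP <- ->; ring.
Qed.

(** Giving [v] the colour [c] is the contraction; the cone point is the vector that colours [v]
    alone. *)
Lemma svec_cone_acyclic (D : {set V}) v (c : 'I_p) k (z : seq svec -> R) :
  v \in D ->
  (forall s, schain D s -> size s = k.+1 ->
     all (fun X => (X v == None) || (X v == Some c)) s -> cobord z s = 0) ->
  exists b, forall s, schain D s -> size s = k ->
     all (fun X => (X v == None) || (X v == Some c)) s -> z s = cobord b s.
Proof.
move=> vD z0.
pose put X : svec := [ffun u => if u == v then Some c else X u].
pose U X := svec_on D X && ((X v == None) || (X v == Some c)).
have putU X : (forall u, u != v -> X u -> u \in D) -> U (put X).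
  move=> XD; rewrite /U ffunE eqxx eqxx orbT andbT; apply/svec_onP; split.
    by exists v, c; rewrite ffunE eqxx.
  move=> u i; rewrite ffunE; case: eqP => [-> //|/eqP uv Xu].
  by apply: XD; rewrite ?Xu.
have [||X Y /sleP XY|s ps|b zb] := @cone_acyclic U put (put [ffun=> None]) _ _ _ k z.
- by apply: putU => u _; rewrite ffunE.
- move=> X /andP[/svec_onP[_ XD] Xv]; split.
  + by apply: putU => u _; case Xu: (X u) => [i|] // _; apply: XD Xu.
  + apply/sleP => u i Xu; rewrite ffunE; case: eqP => // uv.
    by move: Xv; rewrite -uv Xu => /eqP.
  + by apply/sleP => u i; rewrite !ffunE; case: eqP => //; rewrite ffunE.
- by apply/sleP => u i; rewrite !ffunE; case: eqP => // _; apply: XY.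
- by rewrite all_predI => /andP[sD sv] ss; apply: z0; rewrite ?/schain ?ps.
exists b => s /andP[ps sD] ss sv; apply: zb => //.
by rewrite all_predI sD.
Qed.

(** Chains of these vectors subdivide the join of [#|D|] copies of [p] points. For [v] in [D], the
    vectors with [v] uncoloured or coloured [c] form [p] cones, any two of which meet in the vectors
    over [D :\ v]. *)
Lemma svec_acyclic (D : {set V}) k (z : seq svec -> R) : (k < #|D|)%N ->
  (forall s, schain D s -> size s = k.+1 -> cobord z s = 0) ->
  exists b, forall s, schain D s -> size s = k -> z s = cobord b s.
Proof.
move: {2}#|D| (erefl #|D|) => n Dn; elim: n D k z Dn => [|n IH] D k z Dn.
  by rewrite Dn.
move=> kD z0.
have [v vD] : exists v, v \in D by apply/set0Pn; rewrite -card_gt0 Dn.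
pose i0 : 'I_p := Ordinal (prime_gt0 p_prime).
pose on c := all (fun X : svec => (X v == None) || (X v == Some c)).
have /fin_all_exists[b bP] c : exists b, forall s, schain D s -> size s = k ->
    on c s -> z s = cobord b s.
  by apply: svec_cone_acyclic => // s sD ss _; apply: z0.
case: k kD z0 bP => [|k] kD z0 bP.
  by exists (b i0) => s sD ss; apply: bP => //; case: (s) ss.
pose D' := D :\ v.
have D'n : #|D'| = n by have := cardsD1 v D; rewrite vD Dn => -[].
have onD' c s : schain D' s -> on c s.
  case/andP=> _ /allP sD'; apply/allP => X /sD' /svec_onP[_ XD'].
  by case Xv: (X v) => [i|] //; have := XD' v i Xv; rewrite !inE eqxx.
have D'D s : schain D' s -> schain D s.
  case/andP=> ps /allP sD'; rewrite /schain ps; apply/allP => X /sD'.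
  move=> /svec_onP[X0 XD']; apply/svec_onP; split=> // u i /XD'.
  by rewrite inE => /andP[].
(* Mayer-Vietoris: the primitives b c agree on D' up to coboundaries e c *)
have /fin_all_exists[e eP] c : exists e, forall s, schain D' s -> size s = k ->
    b c s - b i0 s = cobord e s.
  apply: IH => //; first by rewrite D'n; move: kD; rewrite Dn ltnS.
  move=> s sD' ss; rewrite cobordB -!bP ?subrr ?D'D ?onD' //.
pose b' c s := b c s - cobord (e c) s.
(* The cone containing [s], if [v] is coloured somewhere in [s]. Otherwise [s] lies over [D'], where
   all [b' c] agree, and any default will do. *)
pose sign (s : seq svec) :=
  if [pick c | has (fun X : svec => X v == Some c) s] is Some c then c else i0.
exists (fun s => b' (sign s) s) => s sD ss.
(* The largest vector of the chain decides the cone. *)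
have [c sc] : exists c, on c s.
  have s0 : s != [::] by case: (s) ss.
  have [Y Ys maxY] := schain_last sD s0.
  exists (if Y v is Some c then c else i0); apply/allP => X /maxY /sleP XY.
  by case Xv: (X v) => [i|] //; rewrite (XY v i Xv) eqxx.
have -> : z s = cobord (b' c) s.
  by rewrite /b' cobordB cobordK subr0; apply: bP.
apply: eq_cobord => u us; rewrite ss => -[su].
have uD := schain_sub us sD.
rewrite /sign; case: pickP => [c' /hasP[X Xu /eqP Xv]|noc].
  have /(allP sc) := mem_subseq us Xu.
  by rewrite Xv /= => /eqP/Some_inj ->.
have uD' : schain D' u.
  case/andP: (uD) => pu /allP uD0; rewrite /schain pu; apply/allP => X Xu.
  have /svec_onP[X0 XD] := uD0 X Xu; apply/svec_onP; split=> // x i Xx.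
  rewrite !inE (XD x i Xx) andbT; apply/eqP => xv.
  by have /hasP[] := noc i; exists X => //; rewrite -xv Xx.
by rewrite /b' -!eP //; ring.
Qed.

End Acyclicity.
End SignedVectors.

(** * The Z_p-Tucker lemma *)

Section Tucker.
Variables (p : nat) (p_prime : prime p) (V J : finType) (D : {set V}).
Variables (lam : svec p V -> 'I_p * J) (w : J -> nat).

Let L := ('I_p * J)%type.
Let turn (l : L) : L := (ordS l.1, l.2).
Let good (s : seq L) := [forall j, #|[set i | (i, j) \in s]| <= w j].

Lemma good_size s : good s -> uniq s -> size s <= \sum_j w j.
Proof.
move=> /forallP gs us.
have -> : size s = \sum_j #|[set i | (i, j) \in s]|.
  rewrite -(card_uniqP us) -cardsE -sum1_card.
  rewrite (partition_big snd predT) //=; apply: eq_bigr => j _.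
  rewrite -sum1_card [RHS](reindex_onto fst (fun i => (i, j))) /=; last by [].
  apply: eq_bigl => -[i j'] /=; rewrite !inE xpair_eqE eqxx /= [j == j']eq_sym.
  by have [->|] := eqVneq j' j; rewrite ?andbF.
exact: leq_sum.
Qed.

(** Weights treat all kinds of label at once: 1 for a label whose sign is constant along chains,
    [p - 1] for one that always misses a sign, 0 for one that never occurs. *)
Theorem Zp_tucker :
  (forall j, w j < p) ->
  (forall X, svec_on D X -> lam (shift X) = (ordS (lam X).1, (lam X).2)) ->
  (forall s j, schain D s -> #|[set i | (i, j) \in map lam s]| <= w j) ->
  #|D| <= \sum_j w j.
Proof.
move=> wp lam_shift lam_chain; rewrite leqNgt; apply/negP => wD.
have p_gt0 := prime_gt0 p_prime.
have turnI : injective turn.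
  by move=> [i j] [i' j'] /eqP; rewrite xpair_eqE /= => /andP[/eqP/ordS_inj -> /eqP ->].
have iter_turn k l : iter k turn l = (iter k (@ordS p) l.1, l.2).
  by elim: k => [|k IH]; [case: l|rewrite iterS IH].
have turnp l : iter p turn l = l by rewrite iter_turn iter_ordS_p -surjective_pairing.
have good_sub u s : subseq u s -> good s -> good u.
  move=> us /forallP gs; apply/forallP => j; apply: leq_trans (gs j).
  by apply/subset_leq_card/subsetP => i; rewrite !inE; apply: mem_subseq.
have turn_mem s i j : ((ordS i, j) \in map turn s) = ((i, j) \in s).
  by rewrite -(mem_map turnI s (i, j)).
have good_turn s : good s -> good (map turn s).
  move=> /forallP gs; apply/forallP => j; apply: leq_trans (gs j).
  rewrite -[X in _ <= X](card_imset _ (@ordS_inj p)); apply/subset_leq_card/subsetP => i.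
  rewrite inE => ijs; apply/imsetP; exists (ord_pred i); last by rewrite ord_predK.
  by rewrite inE -turn_mem ord_predK.
pose turns (A : {set L}) := turn @: A.
have iter_turns k A : iter k turns A = iter k turn @: A.
  elim: k A => [|k IH] A; first by rewrite imset_id.
  by rewrite iterS IH /turns -imset_comp.
have turnsp A : iter p turns A = A.
  by rewrite iter_turns (eq_imset _ turnp) imset_id.
have [sg sgP] := equivariant_choice (Q := fun _ _ => true) p_prime turnsp
  (fun=> ex_intro _ (Ordinal p_gt0) isT) (fun _ _ => id).
pose rho (s : seq L) : nat := sg [set l in s].
(* A rotation-invariant set containing some [(i, j)] would contain [j] with all [p] signs, more than
   [w j]. *)
have turns_neq s : good s -> s != [::] -> turns [set l in s] != [set l in s].
  case: s => // -[i j] s /forallP/(_ j) gs _; set A := [set l in _].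
  apply/eqP => tA.
  have itA k : iter k turns A = A by elim: k => //= k ->.
  have : p <= w j; last by rewrite leqNgt wp.
  apply: leq_trans gs; rewrite -[X in X <= _]card_ord.
  apply/subset_leq_card/subsetP => i' _.
  have [k <-] := iter_ordS_onto i i'.
  have : iter k turn (i, j) \in A.
    by rewrite -(itA k) iter_turns imset_f // inE mem_head.
  by rewrite iter_turn /= !inE.
have rho_turn s : good s -> s != [::] -> rho (map turn s) = (rho s).+1 %% p.
  move=> gs s0; have [_ /(_ (turns_neq s gs s0)) e] := sgP [set l in s].
  rewrite /rho (_ : [set l in map turn s] = turns [set l in s]) ?e //.
  apply/setP => l; rewrite inE; apply/mapP/imsetP => -[x xs ->];
    by exists x; rewrite // inE in xs *.
have rho_lt s : rho s < p by apply: ltn_ord.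
have rho_swap s1 x y s2 : rho (s1 ++ x :: y :: s2) = rho (s1 ++ y :: x :: s2).
  congr (val (sg _)); apply/setP => l; rewrite !inE !mem_cat !inE.
  by congr (_ || _); rewrite orbCA.
pose a k := transfer 'F_p p turn rho k.
pose N := #|D|.
have map_shift s j : schain D s ->
    map lam (map (iter j (@shift p V)) s) = map (iter j turn) (map lam s).
  move=> /andP[_ /allP sD]; rewrite -!map_comp; apply/eq_in_map => X /sD XD /=.
  have iD k : svec_on D (iter k (@shift p V) X).
    by elim: k => //= k; apply: svec_on_shift.
  by elim: j => //= j IH; rewrite lam_shift // IH.
have good_lam s : schain D s -> good (map lam s).
  by move=> sD; apply/forallP => j; apply: lam_chain.
have thetaE k f s : schain D s ->
    theta p turn k f (map lam s) = theta p (@shift p V) k (fun u => f (map lam u)) s.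
  move=> sD; rewrite /theta; case: odd.
    by have /= -> := map_shift s 1 sD.
  by apply: eq_bigr => j _; rewrite map_shift.
have chain_iter s j : schain D s -> schain D (map (iter j (@shift p V)) s).
  move=> sD; elim: j => [|j IH]; first by rewrite map_id.
  by have := schain_shift IH; rewrite -map_comp.
(* The transferred cochains vanish on N vertices.  Descending from N to 0, each
   of them is a coboundary plus an element of the image of theta; but the one of
   degree 0 is the constant 1, while theta 0 multiplies constants by p. *)
have descend i : i <= N -> exists c c', forall s, schain D s -> size s = N - i ->
    a (N - i) (map lam s) = (cobord c s + theta p (@shift p V) (N - i) c' s)%R.
  elim: i => [_|i IH iN].
    exists (fun=> 0%R), (fun=> 0%R) => s sD; rewrite subn0 => sN.
    rewrite cobord0 (@eq_theta _ _ _ _ _ _ (fun u => 0 + 0)%R) => [|j]; last by rewrite addr0.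
    have gs := good_lam s sD.
    rewrite /a (alternating_repeat (alternating_transfer _ _ _ rho_swap _)) //.
      by rewrite /theta; case: odd; rewrite ?big1 ?subrr ?addr0 // => j _; rewrite addr0.
    by apply/negP => us; have := good_size gs us; rewrite size_map sN leqNgt wD.
  have [c [c' cP]] := IH (ltnW iN).
  set k := N - i.+1 in cP *; have kE : N - i = k.+1 by rewrite /k; lia.
  rewrite kE in cP.
  have kN : k < #|D| by rewrite /k -/N; lia.
  (* A cocycle: [cobord] of [a k] is [theta k] of [a k.+1], hence of [cobord c] plus
     [theta k.+1 c'], and the last term dies by [thetaK]. *)
  pose z s := (a k (map lam s) - theta p (@shift p V) k c s)%R.
  have [s sD ss|b bP] := @svec_acyclic p p_prime V 'F_p D k z kN.
    rewrite (cobordB (fun u => a k (map lam u))) cobord_map cobord_theta.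
    rewrite (@transfer_cocycle _ p p_gt0 _ turn good) ?size_map ?good_lam // thetaE //.
    rewrite (@eq_theta _ _ _ _ _ _
      (fun u => cobord c u + theta p (@shift p V) k.+1 c' u)%R).
      by rewrite thetaD thetaK ?addr0 ?subrr // => X; apply: shift_p.
    by move=> j; apply: cP; rewrite ?size_map // chain_iter.
  by exists b, c => s sD ss; rewrite -bP // /z; ring.
have [c [c' /(_ [::])]] := descend N (leqnn N).
rewrite subnn /= => /(_ isT erefl) /eqP; rewrite add0r /theta /= sumr_const card_ord.
by rewrite -[X in _ == X]mulr_natr (pcharf0 (pchar_Fp p_prime)) mulr0 oner_eq0.
Qed.

End Tucker.

(** * Ground sets divided into blocks *)

Section Blocks.
Variables (V B : finType) (blk : V -> B).

Definition block (A : {set V}) (b : B) : {set V} := [set v in A | blk v == b].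

Definition capped (t : nat) (A : {set V}) : Prop := forall b, #|block A b| <= t.

Lemma card_blocks (A : {set V}) : #|A| = \sum_b #|block A b|.
Proof.
rewrite -sum1_card (partition_big blk predT) //=; apply: eq_bigr => b _.
by rewrite -sum1_card; apply: eq_bigl => v; rewrite inE.
Qed.

Lemma blockS (A A' : {set V}) b : A \subset A' -> block A b \subset block A' b.
Proof.
move=> /subsetP AA'; apply/subsetP => v; rewrite !inE => /andP[vA ->].
by rewrite AA'.
Qed.

Lemma cappedS t (A A' : {set V}) : A \subset A' -> capped t A' -> capped t A.
Proof. by move=> AA' cA' b; apply: leq_trans (cA' b); apply/subset_leq_card/blockS. Qed.

(** Greedy: as long as the bound is not reached, some block has room for another point of [X]. *)
Lemma capped_subset t (X : {set V}) n :
  n <= \sum_b minn t #|block X b| ->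
  exists A : {set V}, [/\ A \subset X, capped t A & #|A| = n].
Proof.
elim: n => [|n IH] nX.
  exists set0; split; rewrite ?sub0set ?cards0 // => b.
  by rewrite (_ : block set0 b = set0) ?cards0 //; apply/setP => v; rewrite !inE.
have [A [AX cA An]] := IH (ltnW nX).
have [b Ab] : exists b, #|block A b| < minn t #|block X b|.
  apply/existsP; apply: contraTT nX; rewrite negb_exists => /forallP h.
  rewrite -leqNgt -An card_blocks; apply: leq_sum => b _.
  by move: (h b); rewrite -leqNgt.
have /subsetPn[v vX vA] : ~~ (block X b \subset block A b).
  apply: contraTN Ab => /subset_leq_card le; rewrite -leqNgt.
  by apply: leq_trans le; rewrite geq_minr.
move: vX vA; rewrite !inE => /andP[vX /eqP vb]; rewrite vb eqxx andbT => vA.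
exists (v |: A); split.
- by rewrite subUset sub1set vX.
- move=> b'; have [->|b'b] := eqVneq b' b.
    apply: leq_trans (_ : #|v |: block A b| <= t).
      by apply/subset_leq_card/subsetP => u; rewrite !inE; case: eqP => //=.
    rewrite cardsU1; have := leq_trans Ab (geq_minl _ _).
    by apply: leq_trans; case: (_ \notin _).
  apply: leq_trans (cA b'); apply/subset_leq_card/subsetP => u; rewrite !inE.
  case/andP => /orP[/eqP ->|->] //; rewrite vb => /eqP e.
  by rewrite e eqxx in b'b.
- by rewrite cardsU1 vA An.
Qed.

Variables (r t : nat) (G : {set {set V}}).

Definition equipotent (A : 'I_r -> {set V}) : Prop :=
  forall i j, #|A i| <= #|A j|.+1.

(** The cap restores the block hypothesis when the bound is applied again inside each [A i]; for
    [t = 1] it makes the projection from copies injective. *)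
Definition admissible (U : {set V}) (A : 'I_r -> {set V}) : Prop :=
  [/\ forall i, A i \subset U,
      forall i j, i != j -> [disjoint A i & A j],
      equipotent A,
      forall i, capped t (A i)
    & forall i D, D \in G -> ~~ (D \subset A i)].

(** Points are removed one by one from a largest set, which preserves equitability. *)
Lemma admissible_trim U A m : admissible U A -> m <= \sum_i #|A i| ->
  exists A', admissible U A' /\ \sum_i #|A' i| = m.
Proof.
move: {2}(\sum_i _ - m) (erefl (\sum_i #|A i| - m)) => d.
elim: d A => [|d IH] A dA adA mA; first by exists A; split=> //; lia.
have [i0 _] : exists i0 : 'I_r, #|A i0| != 0.
  apply/existsP; apply: contraPT dA; rewrite negb_exists => /forallP A0.
  by rewrite big1 // => i _; apply/eqP; move: (A0 i); rewrite negbK.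
case: (@arg_maxnP _ i0 predT (fun i => #|A i|) isT) => i1 _ maxA.
have [v vA] : exists v, v \in A i1.
  apply/set0Pn; apply: contraPneq dA => Ai1; rewrite big1 // => i _.
  by apply/eqP; rewrite -leqn0 (leq_trans (maxA i isT)) // Ai1 cards0.
pose A' i := if i == i1 then A i1 :\ v else A i.
have A'A i : A' i \subset A i.
  by rewrite /A'; case: eqP => // ->; apply: subsetDl.
have A'1 : #|A i1| = #|A' i1|.+1 by rewrite /A' eqxx (cardsD1 v) vA.
have A'n i : i != i1 -> A' i = A i by rewrite /A' => /negbTE ->.
have sumA : \sum_i #|A i| = (\sum_i #|A' i|).+1.
  rewrite (bigD1 i1) //= [in RHS](bigD1 i1) //= A'1; congr (_.+1 + _).
  by apply: eq_bigr => i /A'n ->.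
apply: (IH A'); try by lia.
case: adA => AU dA' eA cA GA; split.
- by move=> i; apply: subset_trans (AU i).
- by move=> i j /dA' /(disjointWl (A'A i)) /(disjointWr (A'A j)).
- move=> i j; have [->|ij] := eqVneq j i1; last first.
    rewrite (A'n j ij); apply: leq_trans (eA i j).
    exact/subset_leq_card.
  rewrite -A'1; apply: leq_trans (maxA i isT).
  exact/subset_leq_card.
- by move=> i; apply: cappedS (cA i).
- by move=> i D /(GA i); apply: contra => DA; apply: subset_trans DA _.
Qed.

End Blocks.

(* The form of the bound that passes from the prime factors of r to r; the
   theorem is the case t = 1. *)
Definition defect_bound (r t : nat) : Prop :=
  forall (V B : finType) (blk : V -> B) (G : {set {set V}}) (C : nat)
    (c : {set V} -> nat) (U : {set V}),
  (forall b, #|block blk U b| <= r * t) ->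
  set0 \notin G ->
  (forall D, D \in G -> c D < C) ->
  (forall D : 'I_r -> {set V}, (forall i, D i \in G) ->
     (forall i j, i != j -> [disjoint D i & D j]) ->
     exists i j, c (D i) != c (D j)) ->
  exists2 A : 'I_r -> {set V}, admissible blk t G U A &
    #|U| <= \sum_i #|A i| + (r - 1) * C.

(** * From two factors of [r] to their product *)

Lemma sum_ltn (I : finType) (f g : I -> nat) (j : I) :
  (forall i, f i <= g i) -> f j < g j -> \sum_i f i < \sum_i g i.
Proof.
move=> fg fgj; rewrite (bigD1 j) //= [leqRHS](bigD1 j) //= -addSn.
by rewrite leq_add // leq_sum.
Qed.

(** If [a i j] exceeded [a i' j'] by 2, row [i] would sum to more, and row [i'] to less, than the
    constant row [(a i' j').+1], so the sums would differ by at least 2. *)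
Lemma equipotent_glue r1 r2 (a : 'I_r1 -> 'I_r2 -> nat) :
  (forall i j j', a i j <= (a i j').+1) ->
  (forall i i', \sum_j a i j <= (\sum_j a i' j).+1) ->
  forall i i' j j', a i j <= (a i' j').+1.
Proof.
move=> ea es i i' j j'; rewrite leqNgt; apply/negP => lt.
have h1 : \sum_(k < r2) (a i' j').+1 < \sum_k a i k.
  by apply: (sum_ltn (j := j)) => // k; have := ea i j k; lia.
have h2 : \sum_k a i' k < \sum_(k < r2) (a i' j').+1.
  by apply: (sum_ltn (j := j')) => // k; apply: ea.
by have := es i i'; lia.
Qed.

(** A single set always has the same colour as itself, so [G] must be empty. *)
Lemma defect_bound1 t : defect_bound 1 t.
Proof.
move=> V B blk G C c U Ub G0 cC mono; exists (fun=> U); last first.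
  by rewrite big_ord1 leq_addr.
split=> // [i j|i b|i D DG]; first by rewrite !ord1.
  by have := Ub b; rewrite mul1n.
have [|i0 j0|i1 [j1]] := mono (fun=> D) _; rewrite ?eqxx //.
by rewrite !ord1 eqxx.
Qed.

Lemma defect_bound_mul r1 r2 t : 0 < r1 ->
  defect_bound r1 t -> defect_bound r2 (r1 * t) -> defect_bound (r1 * r2) t.
Proof.
move=> r1_gt0 Q1 Q2 V B blk G C c U Ub G0 cC mono.
pose bad (M : {set V}) := ~ exists2 A : 'I_r1 -> {set V}, admissible blk t G M A &
  #|M| <= \sum_i #|A i| + (r1 - 1) * C.
(* The cap [r1 * t] is the block hypothesis under which the bound for [r1] applies inside [M]. *)
pose T := [set M : {set V} | `[< capped blk (r1 * t) M /\ bad M >]].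
have TP M : M \in T -> exists D : 'I_r1 -> {set V}, [/\ forall i, D i \in G,
    forall i, D i \subset M, forall i j, i != j -> [disjoint D i & D j]
    & forall i j, c (D i) = c (D j)].
  rewrite inE => /asboolP[cM badM]; apply: contrapT => noD; apply: badM.
  pose GM := [set D in G | D \subset M].
  have [] := Q1 V B blk GM C c M cM.
  - by rewrite inE (negbTE G0).
  - by move=> D; rewrite inE => /andP[/cC].
  - move=> D DG dD; apply: contrapT => nc; apply: noD; exists D; split=> //.
    + by move=> i; have := DG i; rewrite inE => /andP[].
    + by move=> i; have := DG i; rewrite inE => /andP[].
    + by move=> i j; apply/eqP/negPn/negP => ne; apply: nc; exists i, j.
  move=> A [AM dA eA cA GA] sA; exists A => //; split=> // i D DG.
  apply/negP => DA; have := GA i D; rewrite inE DG DA (subset_trans DA) //.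
  by move/(_ isT).
have /choice[E EP] : forall M : {set V}, exists D : 'I_r1 -> {set V}, M \in T ->
    [/\ forall i, D i \in G, forall i, D i \subset M,
        forall i j, i != j -> [disjoint D i & D j]
      & forall i j, c (D i) = c (D j)].
  move=> M; case: (boolP (M \in T)) => [/TP[D DP]|_]; first by exists D.
  by exists (fun=> set0).
pose o1 : 'I_r1 := Ordinal r1_gt0.
have [] := Q2 V B blk T C (fun M => c (E M o1)) U.
- by move=> b; rewrite mulnCA mulnA.
- apply/negP; rewrite inE => /asboolP[_ []]; exists (fun=> set0).
    split=> // [i j _|i b|i D DG]; first by rewrite -setI_eq0 setI0.
      rewrite (_ : block blk set0 b = set0) ?cards0 //.
      by apply/setP => v; rewrite !inE.
    by rewrite subset0; apply: contraNneq G0 => <-.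
  by rewrite cards0.
- by move=> M /EP[EG _ _ _]; apply: cC.
- move=> M MT dM; apply: contrapT => nc.
  have cE i i' j j' : c (E (M i) j) = c (E (M i') j').
    have [_ _ _ e] := EP _ (MT i); have [_ _ _ e'] := EP _ (MT i').
    rewrite (e j o1) (e' j' o1); apply/eqP/negPn/negP => ne.
    by apply: nc; exists i, i'.
  have card12 : #|{: 'I_r2 * 'I_r1}| = r1 * r2.
    by rewrite card_prod !card_ord mulnC.
  pose pr (k : 'I_(r1 * r2)) := enum_val (cast_ord (esym card12) k).
  have prI : injective pr by move=> k k' /enum_val_inj/cast_ord_inj.
  have [|k k' kk'|k [k']] := mono (fun k => E (M (pr k).1) (pr k).2).
  + by move=> k; have [] := EP _ (MT (pr k).1).
  + have [e1|n1] := eqVneq (pr k).1 (pr k').1.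
      rewrite e1; have [_ _ dE _] := EP _ (MT (pr k').1); apply: dE.
      apply: contra kk' => /eqP e2; apply/eqP/prI.
      by rewrite [pr k]surjective_pairing e1 e2 -surjective_pairing.
    have [_ s1 _ _] := EP _ (MT (pr k).1); have [_ s2 _ _] := EP _ (MT (pr k').1).
    exact: disjointWl (s1 _) (disjointWr (s2 _) (dM _ _ n1)).
  + by rewrite (cE _ (pr k').1 _ (pr k').2) eqxx.
move=> M [MU dM eM cM TM] sM.
(* Trimming to exactly this total makes the row sums differ by at most 1, as the sizes of the [M i]
   do. *)
have /fin_all_exists[A AP] i : exists A : 'I_r1 -> {set V},
    admissible blk t G (M i) A /\ \sum_j #|A j| = #|M i| - (r1 - 1) * C.
  have : M i \notin T by apply/negP => /(TM i); rewrite subxx.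
  rewrite inE => /asboolPn nT.
  have [A adA sA] : exists2 A : 'I_r1 -> {set V}, admissible blk t G (M i) A &
      #|M i| <= \sum_i #|A i| + (r1 - 1) * C.
    by apply: contrapT => nA; apply: nT; split.
  by apply: (admissible_trim adA); lia.
have card12 : #|{: 'I_r2 * 'I_r1}| = r1 * r2.
  by rewrite card_prod !card_ord mulnC.
pose pr (k : 'I_(r1 * r2)) := enum_val (cast_ord (esym card12) k).
have prI : injective pr by move=> k k' /enum_val_inj/cast_ord_inj.
exists (fun k => A (pr k).1 (pr k).2).
  split.
  - move=> k; have [[s _ _ _ _] _] := AP (pr k).1.
    exact: subset_trans (s _) (MU _).
  - move=> k k' kk'; have [e1|n1] := eqVneq (pr k).1 (pr k').1.
      rewrite e1; have [[_ dE _ _ _] _] := AP (pr k').1; apply: dE.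
      apply: contra kk' => /eqP e2; apply/eqP/prI.
      by rewrite [pr k]surjective_pairing e1 e2 -surjective_pairing.
    have [[s1 _ _ _ _] _] := AP (pr k).1; have [[s2 _ _ _ _] _] := AP (pr k').1.
    exact: disjointWl (s1 _) (disjointWr (s2 _) (dM _ _ n1)).
  - move=> k k'; apply: (equipotent_glue (a := fun i j => #|A i j|)).
      by move=> i j j'; have [[_ _ e _ _] _] := AP i; apply: e.
    move=> i i'; have [_ ->] := AP i; have [_ ->] := AP i'.
    by have := eM i i'; move: ((r1 - 1) * C) => q; rewrite leq_subLR addnS; lia.
  - by move=> k; have [[_ _ _ cA _] _] := AP (pr k).1.
  - by move=> k; have [[_ _ _ _ GA] _] := AP (pr k).1; apply: GA.
have -> : \sum_k #|A (pr k).1 (pr k).2| = \sum_i \sum_j #|A i j|.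
  rewrite pair_bigA /= [RHS](reindex pr) //=.
  apply: onW_bij; apply: inj_card_bij => //; by rewrite card12 card_ord.
apply: leq_trans sM _.
have le : \sum_i #|M i| <= \sum_(i < r2) (\sum_j #|A i j| + (r1 - 1) * C).
  by apply: leq_sum => i _; have [_ ->] := AP i; lia.
apply: leq_trans (leq_add le (leqnn _)) _.
(* The losses add up: r2 (r1 - 1) + (r2 - 1) = r1 r2 - 1. *)
rewrite big_split /= sum_nat_const card_ord -addnA leq_add2l mulnA -mulnDl.
case: (r2) => [|r2']; first by rewrite !mul0n muln0.
by rewrite leq_mul2r; apply/orP; right; nia.
Qed.

(** * Heights and signs of coloured vectors, for [p] prime *)

Section PrimeCase.
Variables (p : nat) (p_prime : prime p) (V B : finType) (blk : V -> B).
Variables (t : nat) (U : {set V}).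

Let p_gt0 : 0 < p := prime_gt0 p_prime.
Let i0 : 'I_p := Ordinal p_gt0.
Implicit Types X Y : svec p V.

Definition part X i : {set V} := [set v | X v == Some i].

Lemma part_shift X i : part (shift X) (ordS i) = part X i.
Proof. by apply/setP => v; rewrite !inE shift_Some. Qed.

Lemma partS X Y i : sle X Y -> part X i \subset part Y i.
Proof. by move=> /sleP XY; apply/subsetP => v; rewrite !inE => /eqP/XY ->. Qed.

Lemma part_disjoint X i j : i != j -> [disjoint part X i & part X j].
Proof.
move=> ij; rewrite -setI_eq0; apply/eqP/setP => v; rewrite !inE.
by case: eqP => //= ->; apply: contraNF ij => /eqP/Some_inj ->.
Qed.

Lemma part_sub X i : svec_on U X -> part X i \subset U.
Proof. by move=> /svec_onP[_ XU]; apply/subsetP => v; rewrite inE => /eqP/XU. Qed.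

Let L := ('I_p * (B * 'I_t))%type.
(** Encodes the block sizes of all classes, truncated at [t], as a set of triples on which rotation
    acts. *)
Definition shape X : {set L} :=
  [set l : L | l.2.2 < #|block blk (part X l.1) l.2.1|].

Definition capsize X i := \sum_b minn t #|block blk (part X i) b|.

Definition mincap X := capsize X [arg min_(i < i0) capsize X i].

(** The largest total of an equitable tuple of capped subsets of the classes: a class of least
    capped size forces all sizes to be at most [(mincap X).+1]. *)
Definition height X := \sum_i minn (capsize X i) (mincap X).+1.

Definition toplist X : {set 'I_p} := [set i | mincap X < capsize X i].

Lemma mincap_le X i : mincap X <= capsize X i.
Proof. by rewrite /mincap; case: arg_minnP => // j _; apply. Qed.

Lemma mincap_eq X : exists i, capsize X i = mincap X.
Proof. by rewrite /mincap; case: arg_minnP => // j _ _; exists j. Qed.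

Lemma mincap_unique X m :
  (forall i, m <= capsize X i) -> (exists i, capsize X i = m) -> mincap X = m.
Proof.
move=> le [i im]; have [j jm] := mincap_eq X.
by apply/eqP; rewrite eqn_leq -{1}im mincap_le -jm le.
Qed.

Lemma capsize_shift X i : capsize (shift X) (ordS i) = capsize X i.
Proof. by rewrite /capsize part_shift. Qed.

Lemma capsize_shift' X i : capsize (shift X) i = capsize X (ord_pred i).
Proof. by rewrite -{1}(ord_predK i) capsize_shift. Qed.

Lemma mincap_shift X : mincap (shift X) = mincap X.
Proof.
apply: mincap_unique => [i|]; first by rewrite capsize_shift' mincap_le.
by have [i e] := mincap_eq X; exists (ordS i); rewrite capsize_shift.
Qed.

Lemma height_shift X : height (shift X) = height X.
Proof.
rewrite /height mincap_shift (reindex (@ordS p)) /=; last first.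
  exact/onW_bij/ordS_bij.
by apply: eq_bigr => i _; rewrite capsize_shift.
Qed.

Lemma toplist_shift X : toplist (shift X) = @ordS p @: toplist X.
Proof.
apply/setP => i; rewrite inE mincap_shift capsize_shift'.
by rewrite -{2}(ord_predK i) (mem_imset _ _ (@ordS_inj p)) inE.
Qed.

Definition turn (l : L) : L := (ordS l.1, l.2).

Lemma turn_inj : injective turn.
Proof.
by move=> [i j] [i' j'] /eqP; rewrite xpair_eqE /= => /andP[/eqP/ordS_inj -> /eqP ->].
Qed.

Lemma shape_shift X : shape (shift X) = turn @: shape X.
Proof.
apply/setP => -[i bk]; rewrite inE /=.
have -> : (i, bk) = turn (ord_pred i, bk) by rewrite /turn /= ord_predK.
by rewrite (mem_imset _ _ turn_inj) inE /= -{1}(ord_predK i) part_shift.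
Qed.

Lemma capsize_shape X i : capsize X i = #|[set bk | (i, bk) \in shape X]|.
Proof.
transitivity (\sum_b \sum_(k : 'I_t | (i, (b, k)) \in shape X) 1); last first.
  by rewrite pair_big_dep /= -sum1_card; apply: eq_bigl => -[b k]; rewrite inE.
apply: eq_bigr => b _; rewrite sum1dep_card.
set n := #|block _ _ _|.
have wI : injective (widen_ord (geq_minl t n)).
  by move=> k k' /(congr1 val) /= /val_inj.
rewrite -[LHS]card_ord -(card_imset _ wI).
apply: eq_card => k; rewrite !inE /= -/n; apply/imsetP/idP => [[k' _ ->]|kn].
  by apply: leq_trans (ltn_ord k') (geq_minr _ _).
have kP : k < minn t n by rewrite leq_min ltn_ord.
by exists (Ordinal kP) => //; apply: val_inj.
Qed.

Lemma shapeS X Y : sle X Y -> shape X \subset shape Y.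
Proof.
move=> XY; apply/subsetP => l; rewrite !inE => lX; apply: leq_trans lX _.
exact/subset_leq_card/blockS/partS.
Qed.

Lemma capsizeS X Y i : sle X Y -> capsize X i <= capsize Y i.
Proof.
move=> /shapeS/subsetP XY; rewrite !capsize_shape; apply/subset_leq_card.
by apply/subsetP => bk; rewrite in_set => ibk; rewrite in_set; apply: XY.
Qed.

Lemma height_gt0 X : 0 < t -> svec_on U X -> 0 < height X.
Proof.
move=> t_gt0 /svec_onP[[v [i Xv]] _]; rewrite /height (bigD1 i) //= addn_gt0.
apply/orP; left; rewrite leq_min /= andbT /capsize (bigD1 (blk v)) //= addn_gt0.
rewrite leq_min t_gt0 /=; apply/orP; left; rewrite card_gt0; apply/set0Pn.
by exists v; rewrite !inE Xv !eqxx.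
Qed.

(** Every summand of [height] is monotone, so equal sums force equal summands. *)
Lemma height_eq X Y : sle X Y -> height X = height Y ->
  mincap X = mincap Y /\ toplist X = toplist Y.
Proof.
move=> XY hXY.
have mXY : mincap X <= mincap Y.
  have [i <-] := mincap_eq Y; exact: leq_trans (mincap_le X i) (capsizeS i XY).
have le i : minn (capsize X i) (mincap X).+1 <= minn (capsize Y i) (mincap Y).+1.
  by have := capsizeS i XY; lia.
have eq i : minn (capsize X i) (mincap X).+1 = minn (capsize Y i) (mincap Y).+1.
  apply/eqP; rewrite eqn_leq le /= leqNgt; apply/negP => lt.
  by have := sum_ltn le lt; rewrite -!/(height _) hXY ltnn.
have mE : mincap X = mincap Y.
  have [i iX] := mincap_eq X; have := eq i; have := mincap_le Y i; lia.
split=> //; apply/setP => i; rewrite !inE.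
by have := eq i; rewrite mE; lia.
Qed.

(** With an empty [toplist] all capped sizes equal [mincap], so the nested shapes have equally many
    triples of each colour. *)
Lemma shape_eq X Y : sle X Y -> height X = height Y -> toplist X = set0 ->
  shape X = shape Y.
Proof.
move=> XY hXY tX; have [mE tE] := height_eq XY hXY.
have cE Z i : toplist Z = set0 -> capsize Z i = mincap Z.
  move=> tZ; apply/eqP; rewrite eqn_leq mincap_le andbT leqNgt.
  by apply/negP => lt; move/setP/(_ i): tZ; rewrite !inE lt.
apply/setP => -[i bk]; apply/idP/idP; first exact: (subsetP (shapeS XY)).
move=> Yl; apply: contraT => Xl.
have : [set x | (i, x) \in shape X] \proper [set x | (i, x) \in shape Y].
  apply/properP; split; last by exists bk; rewrite in_set.
  by apply/subsetP => x; rewrite in_set => ix; rewrite in_set (subsetP (shapeS XY)).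
move/proper_card; rewrite -!capsize_shape cE // cE -?tE // mE.
by rewrite ltnn.
Qed.

Lemma height_subset X : exists A : 'I_p -> {set V},
  [/\ forall i, A i \subset part X i, forall i, capped blk t (A i),
      equipotent A & \sum_i #|A i| = height X].
Proof.
have /fin_all_exists[A AP] i : exists A : {set V},
    [/\ A \subset part X i, capped blk t A
      & #|A| = minn (capsize X i) (mincap X).+1].
  exact: capped_subset (geq_minl _ _).
exists A; split=> [i|i|i j|]; try by have [] := AP i.
  have [_ _ ->] := AP i; have [_ _ ->] := AP j.
  by have := mincap_le X j; lia.
by apply: eq_bigr => i _; have [] := AP i.
Qed.

Hypothesis t_gt0 : 0 < t.
Hypothesis U_blocks : forall b, #|block blk U b| <= p * t.

(** A point coloured only by [Y] must lie in a block where its class in [X] already has [t] points,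
    as the shape does not grow. By invariance all [p] classes have [t] points there, so the block
    would have more than [p * t]. *)
Lemma svec_eq X Y : svec_on U Y -> sle X Y -> shape X = shape Y ->
  turn @: shape X = shape X -> X = Y.
Proof.
move=> YU XY sE tX; apply/ffunP => v.
case Xv: (X v) => [i|]; first by move/sleP: XY => /(_ v i Xv).
case Yv: (Y v) => [i|] //; exfalso; set b := blk v.
have vU : v \in U by move/svec_onP: YU => [_]; apply; exact: Yv.
have lt : #|block blk (part X i) b| < #|block blk (part Y i) b|.
  apply: proper_card; apply/properP; split; first exact/blockS/partS.
  by exists v; rewrite !inE ?Yv ?Xv ?eqxx.
have tXi : t <= #|block blk (part X i) b|.
  rewrite leqNgt; apply/negP => kt; pose k := Ordinal kt.
  have : (i, (b, k)) \in shape Y by rewrite inE.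
  by rewrite -sE inE /= ltnn.
have tall i' : t <= #|block blk (part X i') b|.
  have kt : t.-1 < t by rewrite prednK.
  pose k := Ordinal kt.
  have il : (i, (b, k)) \in shape X by rewrite inE /= prednK.
  have turnk j : (iter j (@ordS p) i, (b, k)) \in shape X.
    by elim: j => //= j IH; rewrite -tX; apply/imsetP; eexists; first exact: IH.
  have [j e] := iter_ordS_onto i i'; have := turnk j.
  by rewrite e inE /= prednK.
have := U_blocks b; rewrite leqNgt => /negP; apply.
apply: leq_ltn_trans (_ : p * t < #|block blk U b|) => //.
rewrite (cardsD1 v) inE vU eqxx add1n ltnS.
apply: leq_trans (_ : \sum_(i' < p) #|block blk (part X i') b| <= _).
  rewrite -[X in X * _](card_ord p) -sum_nat_const.
  by apply: leq_sum => i' _.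
under eq_bigr do rewrite -sum1_card.
rewrite -partition_disjoint_bigcup /= ?sum1_card => [|j j' jj']; last first.
  apply: disjointWl (disjointWr _ (part_disjoint X jj'));
    by apply/subsetP => u; rewrite inE => /andP[].
apply/subset_leq_card/subsetP => u /bigcupP[j _]; rewrite !inE => /andP[/eqP Xu ->].
have /svec_onP[_ YD] := YU; move/sleP: XY => /(_ _ _ Xu)/YD ->.
by rewrite !andbT; apply/eqP => uv; rewrite uv Xv in Xu.
Qed.

Lemma turn_p l : iter p turn l = l.
Proof.
have e k : iter k turn l = (iter k (@ordS p) l.1, l.2).
  by elim: k => [|k IH]; [case: l|rewrite iterS IH].
by rewrite e iter_ordS_p -surjective_pairing.
Qed.

Lemma iter_imset (T : finType) (f : T -> T) k (A : {set T}) :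
  iter k (fun A : {set T} => f @: A) A = iter k f @: A.
Proof.
elim: k A => [|k IH] A; first by rewrite imset_id.
by rewrite iterS IH -imset_comp.
Qed.

(** A class of least capped size is missing from [toplist], and rotation is transitive on
    colours. *)
Lemma toplist_turn X : toplist X != set0 -> @ordS p @: toplist X != toplist X.
Proof.
move=> /set0Pn[i iX]; apply/eqP => e.
have [j jm] := mincap_eq X.
have : j \in toplist X; last by rewrite inE jm ltnn.
have [k <-] := iter_ordS_onto i j; elim: k => //= k IH.
by rewrite -e imset_f.
Qed.

(* Of two comparable vectors of the same height, either both have the same
   nonempty toplist, or the same shape, or they are equal; each of these data
   is moved by the rotation unless it falls into the next case. *)
Lemma height_sign : exists sg : svec p V -> 'I_p,
  (forall X, svec_on U X -> sg (shift X) = ordS (sg X)) /\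
  (forall X Y, svec_on U X -> svec_on U Y -> sle X Y -> height X = height Y ->
     sg X = sg Y).
Proof.
have triv (W : Type) : forall x : W, exists i : 'I_p, true by exists i0.
have [s1 s1P] := equivariant_choice (Q := fun _ _ => true) p_prime
  (fun A : {set 'I_p} => etrans (iter_imset (@ordS p) p A)
     (etrans (eq_imset _ (@iter_ordS_p p)) (imset_id A)))
  (triv _) (fun _ _ => id).
have [s2 s2P] := equivariant_choice (Q := fun _ _ => true) p_prime
  (fun A : {set L} => etrans (iter_imset turn p A)
     (etrans (eq_imset _ turn_p) (imset_id A)))
  (triv _) (fun _ _ => id).
have [s3 s3P] := equivariant_choice (Q := fun _ _ => true) p_prime
  (@shift_p p V) (triv _) (fun _ _ => id).
exists (fun X => if toplist X != set0 then s1 (toplist X) else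
  if turn @: shape X != shape X then s2 (shape X) else s3 X); split.
  move=> X XU; rewrite toplist_shift shape_shift imset_eq0.
  case: ifPn => [/toplist_turn tX|_]; first by have [_ ->] := s1P (toplist X).
  rewrite (inj_eq (imset_inj turn_inj)).
  case: ifPn => [tX|_]; first by have [_ ->] := s2P (shape X).
  by have [_ ->] := s3P X; last exact: shift_neq XU.
move=> X Y XU YU XY hXY; have [_ <-] := height_eq XY hXY.
case: ifPn => // /negPn/eqP tX.
have sE := shape_eq XY hXY tX; rewrite -sE.
by case: ifPn => // /negPn/eqP /(svec_eq YU XY sE) ->.
Qed.

End PrimeCase.

(** * The bound for prime [r], then for every [r] *)

Lemma defect_bound_prime p t : prime p -> 0 < t -> defect_bound p t.
Proof.
move=> p_prime t_gt0 V B blk G C c U Ub G0 cC mono.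
have p_gt0 := prime_gt0 p_prime.
(* Empty sets suffice in the first case; otherwise [M] is positive, and the contradiction hypothesis
   keeps every admissible total below [M]. *)
have [le|] := leqP #|U| ((p - 1) * C).
  exists (fun=> set0); last by rewrite (leq_trans le) // leq_addl.
  split=> // [i|i j _|i b|i D DG]; first exact: sub0set.
  - by rewrite -setI_eq0 setI0.
  - rewrite (_ : block blk set0 b = set0) ?cards0 //.
    by apply/setP => v; rewrite !inE.
  - by rewrite subset0; apply: contraNneq G0 => <-.
rewrite -subn_gt0; set M := #|U| - _ => M_gt0; apply: contrapT => noA.
have small A : admissible blk t G U A -> \sum_(i < p) #|A i| < M.
  move=> adA; rewrite ltnNge; apply/negP => le; apply: noA; exists A => //.
  by rewrite addnC -leq_subLR.
pose hit X (k : 'I_C) (i : 'I_p) :=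
  [exists D : {set V}, [&& D \in G, D \subset part X i & c D == k]].
have hit_shift (X : svec p V) k i : hit (shift X) k (ordS i) = hit X k i.
  by rewrite /hit part_shift.
pose col (X : svec p V) := [pick k | [exists i, hit X k i]].
have col_shift X : col (shift X) = col X.
  apply: eq_pick => k; apply/existsP/existsP => -[i iX]; last first.
    by exists (ordS i); rewrite hit_shift.
  by exists (ord_pred i); rewrite -hit_shift ord_predK.
have [|X i|sb sbP] := equivariant_choice
  (Q := fun X i => if col X is Some k then hit X k i else true)
  p_prime (@shift_p p V).
- move=> X; rewrite /col; case: pickP => [k /existsP //|_].
  by exists (Ordinal p_gt0).
- by rewrite col_shift; case: (col X) => // k; rewrite hit_shift.
have [ss [ss_shift ss_eq]] := height_sign p_prime t_gt0 Ub.
have Mpos : M.-1.+1 = M by rewrite prednK.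
pose lam (X : svec p V) : 'I_p * ('I_M.-1.+1 + 'I_C) :=
  if col X is Some k then (sb X, inr k)
  else (ss X, inl (inord (height p_prime blk t X))).
(* Heights are positive, so height 0 gets weight 0. The total is (M - 1) + (p - 1) C = |U| - 1, one
   too small for the Tucker lemma. *)
pose w (j : 'I_M.-1.+1 + 'I_C) := match j with
  | inl k => (k != ord0) : nat
  | inr _ => p - 1
  end.
have heightM X : svec_on U X -> col X = None -> height p_prime blk t X < M.
  move=> XU; rewrite /col; case: pickP => // noc _.
  have [A [AX cA eA <-]] := height_subset p_prime blk t X.
  apply: small; split=> // [i|i j ij|i D DG].
  - exact: subset_trans (AX i) (part_sub _ XU).
  - exact: disjointWl (AX i) (disjointWr (AX j) (part_disjoint X ij)).
  - apply/negP => DA; have /existsP[] := noc (Ordinal (cC D DG)).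
    exists i; apply/existsP; exists D; rewrite DG eqxx andbT.
    exact: subset_trans DA (AX i).
suff : #|U| <= \sum_j w j.
  rewrite big_sumType /= sum_nat_const card_ord big_ord_recl /= add0n.
  rewrite sum_nat_const card_ord muln1; move: M_gt0; rewrite /M.
  by rewrite [C * _]mulnC; lia.
apply: (Zp_tucker p_prime (lam := lam)) => [[k|k] /=|X XU|s [k|k] sU].
- by case: (k != _); rewrite ?prime_gt1.
- by rewrite subn1 prednK.
- rewrite /lam col_shift; have [_ ->] := sbP X; last exact: shift_neq XU.
  by case: (col X) => // ; rewrite ss_shift // height_shift.
- have sP i : (i, inl k) \in map lam s -> exists X, [/\ X \in s, svec_on U X,
      ss X = i & height p_prime blk t X = k].
    move=> /mapP[X Xs lX]; exists X.
    have XU : svec_on U X by case/andP: sU => _ /allP; apply.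
    move: lX; rewrite /lam; case cX: (col X) => [k'|] [] // -> ->; split=> //.
    by rewrite inordK // Mpos heightM.
  rewrite /w; case: eqP => [k0|_] /=.
    rewrite leqn0 cards_eq0; apply/eqP/setP => i; rewrite !inE; apply/negP.
    move=> /sP[X [_ XU _ hX]]; have := height_gt0 p_prime blk t_gt0 XU.
    by rewrite hX k0.
  apply/card_le1_eqP => i i'; rewrite !inE.
  move=> /sP[X [Xs XU <- hX]] /sP[Y [Ys YU <- hY]].
  case/orP: (schain_total sU Xs Ys) => [XY|YX].
    by apply/esym/ss_eq => //; rewrite hX hY.
  by apply: ss_eq => //; rewrite hX hY.
(* If [k] occurred with all [p] signs, the classes of the largest vector of the chain would contain
   [p] disjoint members of [G], all coloured [k]. *)
- rewrite /w leqNgt; apply/negP => lt.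
  have all_i i : (i, inr k) \in map lam s.
    have : [set i | (i, inr k) \in map lam s] == setT.
      rewrite eqEcard subsetT cardsT card_ord; apply: leq_trans lt; lia.
    by move/eqP/setP/(_ i); rewrite !inE.
  have s0 : s != [::] by have := all_i (Ordinal p_gt0); case: (s).
  have [Y Ys maxY] := schain_last sU s0.
  have /fin_all_exists[D DP] i : exists D : {set V},
      [/\ D \in G, D \subset part Y i & c D = k].
    have /mapP[X Xs] := all_i i; rewrite /lam; case cX: (col X) => [k'|] //.
    move=> [iE kE]; have [+ _] := sbP X; rewrite cX -iE -kE.
    case/existsP => D /and3P[DG DX /eqP cD]; exists D; split=> //.
    exact: subset_trans DX (partS _ (maxY X Xs)).
  have [i|i j ij|i [j]] := mono D; first by have [] := DP i.
    have [_ Di _] := DP i; have [_ Dj _] := DP j.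
    exact: disjointWl Di (disjointWr Dj (part_disjoint Y ij)).
  by have [_ _ ->] := DP i; have [_ _ ->] := DP j; rewrite eqxx.
Qed.

Lemma defect_boundP r t : 0 < r -> 0 < t -> defect_bound r t.
Proof.
elim/ltn_ind: r t => r IH t r_gt0 t_gt0.
have [r1|r_gt1] := leqP r 1.
  have -> : r = 1 by lia.
  exact: defect_bound1.
have q_prime := pdiv_prime r_gt1.
have rE : r = pdiv r * (r %/ pdiv r) by rewrite mulnC divnK // pdiv_dvd.
have q_gt0 := prime_gt0 q_prime.
rewrite rE; apply: defect_bound_mul => //.
  exact: defect_bound_prime.
apply: IH; rewrite ?muln_gt0 ?q_gt0 //.
  by apply: ltn_Pdiv; rewrite ?prime_gt1.
by rewrite divn_gt0 // dvdn_leq // pdiv_dvd.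
Qed.

(** * Application to Kneser hypergraphs *)

Lemma ecd_le_colors (n r k : nat) (S : 'I_n -> nat) (F P : {set {set 'I_n}}) :
  0 < r -> set0 \notin F -> partition P [set: 'I_n] ->
  (forall B, B \in P -> weight S B <= r) ->
  colorable (KG r S F P) k -> ecd r S F <= (r - 1) * k.
Proof.
move=> r_gt0 F0 partP wP /existsP[col /forallP properc].
(* S i labelled copies of each i turn S-disjointness into disjointness *)
pose V := {i : 'I_n & 'I_(S i)}.
pose blk (v : V) := pblock P (tag v).
pose pi (D : {set V}) : {set 'I_n} := [set tag v | v in D].
pose G := [set D : {set V} | pi D \in KG_vertices F P].
(* The default 0 is never taken on [G]. *)
pose c (D : {set V}) : nat :=
  if insub (pi D) : option (KG_vertex F P) is Some x then col x else 0.
have fiber i : #|[set v : V | tag v == i]| = S i.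
  rewrite -[RHS]card_ord.
  rewrite -(card_imset _ (@eq_from_Tagged _ (fun i => 'I_(S i)) i)).
  apply: eq_card => v; rewrite inE; apply/eqP/imsetP => [<-|[a _ ->] //].
  by exists (tagged v) => //; case: (v).
have cardV : #|[set: V]| = \sum_(i < n) S i.
  rewrite -sum1_card (partition_big (@tag _ _) predT) //=.
  by apply: eq_bigr => i _; rewrite -fiber -sum1dep_card; apply: eq_bigl => v; rewrite inE.
have inP i : pblock P i \in P.
  by rewrite pblock_mem // (cover_partition partP) inE.
have trivP : trivIset P by case/and3P: partP.
have pblockE i B : B \in P -> (pblock P i == B) = (i \in B).
  move=> BP; apply/eqP/idP => [<-|iB]; last exact: def_pblock.
  by rewrite mem_pblock (cover_partition partP) inE.
have disjP (D : {ffun 'I_r -> {set 'I_n}}) (E : 'I_r -> {set V}) :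
    (forall j, D j = pi (E j)) ->
    (forall i j, i != j -> [disjoint E i & E j]) -> S_disjoint S D.
  move=> DE dE; apply/forallP => i; rewrite -fiber -sum1dep_card.
  apply: leq_trans (_ : \sum_j #|E j :&: [set v | tag v == i]| <= _).
    rewrite big_mkcond /=; apply: leq_sum => j _; case: ifP => //.
    rewrite DE => /imsetP[v vE ->]; rewrite card_gt0; apply/set0Pn.
    by exists v; rewrite !inE vE eqxx.
  under eq_bigr do rewrite -sum1_card.
  rewrite -partition_disjoint_bigcup /= ?sum1_card => [|j j' jj']; last first.
    by apply: disjointWl (disjointWr _ (dE _ _ jj')); apply: subsetIl.
  by apply/subset_leq_card/bigcupsP => j _; apply: subsetIr.
have cE D (h : pi D \in KG_vertices F P) : c D = col (exist _ (pi D) h).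
  by rewrite /c (insubT (fun B => B \in KG_vertices F P) h).
have [b||D|D DG dD|A [AV dA eA cA GA]] := defect_boundP r_gt0 (ltn0Sn 0)
    (blk := blk) (G := G) (C := k) (c := c) (U := [set: V]).
- rewrite muln1; case: (boolP (b \in P)) => [bP|bP]; last first.
    rewrite (_ : block blk setT b = set0) ?cards0 //; apply/setP => v.
    by rewrite !inE /=; apply/eqP => e; rewrite -e /blk inP in bP.
  apply: leq_trans (wP b bP); rewrite -sum1_card /weight.
  rewrite (partition_big (@tag _ _) (mem b)) /=; last first.
    by move=> v; rewrite !inE /= /blk pblockE.
  apply: leq_sum => i ib; rewrite -fiber sum1dep_card.
  by apply/subset_leq_card/subsetP => v; rewrite !inE => /andP[].
- by rewrite !inE /pi imset0 (negbTE F0).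
- by rewrite inE => DG; rewrite (cE D DG).
- have piG j : pi (D j) \in KG_vertices F P by have := DG j; rewrite inE.
  pose e : {ffun 'I_r -> KG_vertex F P} := [ffun j => exist _ (pi (D j)) (piG j)].
  have /implyP/(_ _)/forallPn[|i /forallPn[j ij]] := properc e.
    by apply: (disjP _ D) => // j; rewrite !ffunE.
  by exists i, j; rewrite (cE _ (piG i)) (cE _ (piG j)); move: ij; rewrite !ffunE.
rewrite cardV => leA; rewrite /ecd leq_subLR addnC.
apply: leq_trans leA _; rewrite [X in _ <= X]addnC leq_add2r.
pose a : {ffun 'I_r -> {set 'I_n}} := [ffun i => pi (A i)].
(* Copies of one element share a block, and [A i] has at most one point per block. *)
have cardA i : #|a i| = #|A i|.
  rewrite ffunE card_in_imset // => v v' vA v'A e.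
  have /card_le1_eqP := cA i (blk v); apply; rewrite inE ?vA ?v'A ?eqxx //.
  by rewrite /blk e eqxx.
under eq_bigr do rewrite -cardA.
apply: (leq_bigmax_cond (F := fun A : {ffun 'I_r -> {set 'I_n}} => \sum_i #|A i|)).
apply/and3P; split.
- apply/forallP => i; apply/forallP => j; rewrite !cardA.
  by have := eA i j; have := eA j i; lia.
- by apply: (disjP _ A) => // j; rewrite ffunE.
apply/forallP => E; apply/implyP => EF; apply/forallP => i; rewrite ffunE.
(* The points of [A i] over [E] project onto [E]; the cap 1 makes [E] a vertex of the hypergraph, so
   this set is in [G] although it lies in [A i]. *)
apply/negP => EA; pose D := A i :&: [set v | tag v \in E].
have piD : pi D = E.
  apply/setP => x; apply/imsetP/idP => [[v + ->]|xE].
    by rewrite !inE => /andP[].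
  have /imsetP[v vA xv] := subsetP EA x xE.
  by exists v; rewrite // !inE vA -xv.
have : ~~ (D \subset A i).
  apply: GA; rewrite inE piD inE EF; apply/forallP => Q; apply/implyP => QP.
  apply: leq_trans (cA i Q); apply: leq_trans (leq_imset_card (@tag _ _) _).
  apply/subset_leq_card/subsetP => x; rewrite inE => /andP[xE xQ].
  have /imsetP[v vA xv] := subsetP EA x xE.
  by rewrite xv imset_f // inE vA /blk pblockE // -xv.
by rewrite subsetIl.
Qed.

Theorem theorem6 (n r : nat) (S : 'I_n -> nat) (F P : {set {set 'I_n}}) :
  1 <= n -> 2 <= r ->
  (forall i, S i <= r) ->
  set0 \notin F ->
  partition P [set: 'I_n] ->
  (forall B, B \in P -> weight S B <= r) ->
  ((Num.ceil ((ecd r S F)%:R / (r - 1)%:R : rat)%R)%:E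
     <= chromatic_number (KG r S F P))%E.
Proof.
move=> _ r2 _ F0 partP wP; rewrite /chromatic_number.
case: pselect => [exk|_]; last by rewrite leey.
case: ex_minnP => k kcol _; rewrite lee_fin Num.Theory.ceil_le_int.
rewrite Num.Theory.ler_pdivrMr ?Num.Theory.ltr0n; last by lia.
rewrite -pmulrn -natrM Num.Theory.ler_nat mulnC.
by apply: ecd_le_colors kcol => //; apply: ltnW.
Qed.
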